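(* Let $G$ and $H$ be finite simple graphs with $\operatorname{im}(G)=t$ and $\operatorname{im}(H)=r$, where $r\geq 3$, and suppose $K_r$ is a subgraph of $H$. Then $\operatorname{im}(G\times H)\geq (t-1)(r-1)+1$.
   Context: All graphs are finite and simple. A graph $G$ has a $G'$-immersion if there is an injective map $\phi:V(G')\to V(G)$ such that for every edge $uv\in E(G')$ there is a path in $G$ joining $\phi(u)$ and $\phi(v)$, and these paths are pairwise edge-disjoint. The immersion number $\operatorname{im}(G)$ is the largest $t$ such that $G$ has a $K_t$-immersion. The direct product $G\times H$ has vertex set $V(G)\times V(H)$, with $(g,h)$ adjacent to $(g',h')$ if and only if $gg'\in E(G)$ and $hh'\in E(H)$. $K_r$ denotes the complete graph on $r$ vertices. *)

(* Defs.v *)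
From mathcomp Require Import all_boot all_order all_algebra.
From mathcomp Require Import boolp.

Set Implicit Arguments.
Unset Strict Implicit.
Unset Printing Implicit Defensive.

Record sgraph := SGraph {
  vertex :> finType;
  adj : rel vertex;
  adj_sym : symmetric adj;
  adj_irr : irreflexive adj }.

Arguments adj {s}.
Arguments adj_sym {s}.
Arguments adj_irr {s}.

Section CompleteGraph.
Variable n : nat.

Definition complete_adj : rel 'I_n := fun i j => i != j.

Lemma complete_adj_sym : symmetric complete_adj.
Proof. by move=> i j; rewrite /complete_adj eq_sym. Qed.

Lemma complete_adj_irr : irreflexive complete_adj.
Proof. by move=> i; rewrite /complete_adj eqxx. Qed.

Definition complete : sgraph := SGraph complete_adj_sym complete_adj_irr.
End CompleteGraph.

Section DirectProduct.
Variables G H : sgraph.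

Definition direct_adj : rel (G * H) := fun x y => adj x.1 y.1 && adj x.2 y.2.

Lemma direct_adj_sym : symmetric direct_adj.
Proof.
by move=> x y; rewrite /direct_adj (adj_sym x.1) (adj_sym x.2).
Qed.

Lemma direct_adj_irr : irreflexive direct_adj.
Proof. by move=> x; rewrite /direct_adj adj_irr. Qed.

Definition direct_product : sgraph := SGraph direct_adj_sym direct_adj_irr.
End DirectProduct.

(* Not necessarily induced, and up to isomorphism: G' embeds in G. *)
Definition is_subgraph (G' G : sgraph) : Prop :=
  exists f : G' -> G, injective f /\ forall u v, adj u v -> adj (f u) (f v).

(* An edge uv is the two-element set {u, v}. *)
Definition edges (G : sgraph) : {set {set G}} :=
  [set [set p.1; p.2] | p in [pred p : G * G | adj p.1 p.2]].

(* A path is given by the list of all its vertices, both ends included. *)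
Definition path_from_to (G : sgraph) (x y : G) (s : seq G) : bool :=
  if s is z :: p then [&& z == x, last z p == y, path adj z p & uniq s]
  else false.

(* Paths joining the ends of an (unoriented) edge may be listed in either
   direction. *)
Definition joins (G : sgraph) (x y : G) (s : seq G) : bool :=
  path_from_to x y s || path_from_to y x s.

Definition path_edges (G : sgraph) (s : seq G) : {set {set G}} :=
  if s is z :: p then [set e in pairmap (fun a b => [set a; b]) z p]
  else set0.

(* The paths P are indexed by unoriented edges, so that there is exactly one
   path for each edge of G'. *)
Definition has_immersion (G' G : sgraph) : Prop :=
  exists (phi : G' -> G) (P : {set G'} -> seq G),
    [/\ injective phi,
        forall u v, adj u v -> joins (phi u) (phi v) (P [set u; v])
      & {in edges G' &, forall e f, e != f ->
          [disjoint path_edges (P e) & path_edges (P f)]}].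

(* The bound t <= #|G| is automatic because immersions are injective on
   vertices; see immersion_numberP. *)
Definition immersion_number (G : sgraph) : nat :=
  \max_(t < #|G|.+1 | `[< has_immersion (complete t) G >]) t.

Lemma has_immersion_card (G : sgraph) (t : nat) :
  has_immersion (complete t) G -> t <= #|G|.
Proof.
by case=> phi [P [phi_inj _ _]]; have := leq_card phi phi_inj; rewrite card_ord.
Qed.

Lemma has_immersion_complete0 (G : sgraph) : has_immersion (complete 0) G.
Proof.
exists (fun i : 'I_0 => match notF (ltn_ord i) with end), (fun=> [::]).
by split=> [[]|[]|e f _ _ _] //; rewrite /path_edges disjoints_subset sub0set.
Qed.

Lemma immersion_numberP (G : sgraph) :
  has_immersion (complete (immersion_number G)) G /\
  (forall t, has_immersion (complete t) G -> t <= immersion_number G).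
Proof.
split=> [|t tP].
  have p0 : `[< has_immersion (complete (@ord0 #|G|)) G >].
    by apply/asboolP; exact: has_immersion_complete0.
  rewrite /immersion_number (bigmax_eq_arg _ p0).
  by case: arg_maxnP => // i /asboolP.
have lt_t : t < #|G|.+1 by rewrite ltnS; exact: has_immersion_card.
by apply: (leq_bigmax_cond (Ordinal lt_t)); apply/asboolP.
Qed.

(* Main.v *)
Require Import Defs.
From mathcomp Require Import all_boot all_order all_algebra.

(* Two steps, composed by transitivity of immersion.

   First, K_t x K_r immerses in G x K_r: a path of G from u to v carries, for all
   a <> b simultaneously, edge-disjoint routes from (u, a) to (v, b). Going one
   edge further along the path replaces a by ab, where the product is an
   idempotent Latin square on r >= 3 points; the Latin property is exactly
   edge-disjointness, and idempotence makes each step an edge of K_r.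

   Second, K_((t-1)(r-1)+1) immerses in K_t x K_r with terminals (0, 0) and its
   neighbours (i, j), i, j <> 0. Adjacent terminals use their edge. The terminals
   (i, j) and (i, l) are joined through the hub (0, x), where x is the colour of
   jl in a colouring of the clique on the nonzero indices; columns are symmetric.
   If r is even, Z_(r-1) with x = (j + l) / 2 colours everything. If r is odd,
   the same formula on Z_r leaves out the pairs l = - j, and then j misses one
   further colour j / 2. If t is odd too, rows use the free edges of the column
   hubs and vice versa; otherwise the free edges at (0, j / 2) and (0, l / 2)
   are linked through (i, 0). *)

Set Implicit Arguments.
Unset Strict Implicit.
Unset Printing Implicit Defensive.

(** * Paths, and immersions as ownership of edges *)

Lemma set2_eqP (T : finType) (a b c d : T) :
  [set a; b] = [set c; d] -> (a = c /\ b = d) \/ (a = d /\ b = c).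
Proof.
move=> eq_ab.
have := set21 a b; rewrite eq_ab => /set2P ha.
have := set22 a b; rewrite eq_ab => /set2P hb.
have := set21 c d; rewrite -eq_ab => /set2P hc.
have := set22 c d; rewrite -eq_ab => /set2P hd.
by case: ha hb hc hd => -> [] -> [] ? [] ?; subst; auto.
Qed.

Lemma path_pairmap_set2 (T : finType) (e : rel T) z p (f : {set T}) :
  path e z p -> f \in pairmap (fun a b => [set a; b]) z p ->
  exists x y, f = [set x; y] /\ e x y.
Proof.
elim: p z => //= a p IHp z /andP[eza pp]; rewrite inE => /orP[/eqP->|/(IHp _ pp)//].
by exists z, a.
Qed.

Lemma path_edge_refine (T : finType) (e : rel T) (S : pred {set T}) z p :
  path e z p -> {subset pairmap (fun a b => [set a; b]) z p <= S} ->
  path [rel x y | e x y && ([set x; y] \in S)] z p.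
Proof.
elim: p z => //= a p IHp z /andP[-> pp] sub /=; rewrite sub ?inE ?eqxx //=.
by apply: IHp => // f fp; apply: sub; rewrite inE fp orbT.
Qed.

Lemma connect_map (T U : finType) (e : rel T) (e' : rel U) (f : T -> U) :
  (forall x y, e x y -> connect e' (f x) (f y)) ->
  forall x y, connect e x y -> connect e' (f x) (f y).
Proof.
move=> fe x _ /connectP[p pp ->].
elim: p x pp => //= a p IHp x /andP[/fe xa /IHp]; exact: connect_trans.
Qed.

Definition owned (G' G : sgraph) (own : G -> G -> {set G'}) (e : {set G'}) : rel G :=
  [rel x y | adj x y && (own x y == e)].

(* Edge-disjointness is encoded by letting every edge xy of G belong to at most
   one edge [own x y] of G', which makes concatenating routes painless. *)
Definition immerses (G' G : sgraph) : Prop :=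
  exists (phi : G' -> G) (own : G -> G -> {set G'}),
    [/\ injective phi,
        forall x y, adj x y -> own x y = own y x
      & forall u v, adj u v -> connect (owned own [set u; v]) (phi u) (phi v)].

Lemma owned_sym (G' G : sgraph) (own : G -> G -> {set G'}) e :
  (forall x y, adj x y -> own x y = own y x) -> symmetric (owned own e).
Proof.
move=> own_sym x y; rewrite /owned /= adj_sym.
by case: (boolP (adj y x)) => //= /own_sym->.
Qed.

Lemma connect_owned_sym (G' G : sgraph) (own : G -> G -> {set G'}) e :
  (forall x y, adj x y -> own x y = own y x) -> connect_sym (owned own e).
Proof. by move=> own_sym; apply: sym_connect_sym; apply: owned_sym. Qed.

Lemma immerses_of_has_immersion (G' G : sgraph) :
  has_immersion G' G -> immerses G' G.
Proof.
case=> phi [P [phi_inj Pjoin Pdisj]].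
pose own x y := odflt set0 [pick e in edges G' | [set x; y] \in path_edges (P e)].
have own_sym (x y : G) : adj x y -> own x y = own y x.
  by move=> _; rewrite /own setUC.
exists phi, own; split=> // u v uv.
have e_in : [set u; v] \in edges G' by apply/imsetP; exists (u, v).
have conn x y : path_from_to x y (P [set u; v]) ->
    connect (owned own [set u; v]) x y.
  case defP: (P _) => [|z p] //= /and4P[/eqP<- /eqP<- pp _].
  apply/connectP; exists p => //.
  have /(path_edge_refine pp) :
      {subset pairmap (fun a b => [set a; b]) z p <= path_edges (P [set u; v])}.
    by move=> f; rewrite defP inE.
  apply: sub_path => x' y' /andP[xy in_e]; rewrite /owned /= xy /own.
  case: pickP => [f /andP[fE in_f]|/(_ [set u; v])] /=; last by rewrite e_in [X in X = _]in_e.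
  apply: contraT => /(Pdisj _ _ fE e_in) /pred0P /(_ [set x'; y']) /=.
  by rewrite in_f [X in _ && X]in_e.
case/orP: (Pjoin _ _ uv) => /conn //; by rewrite connect_owned_sym.
Qed.

(** Routes are shortened to simple paths, chosen once per set [e] rather than per oriented pair; an
    edge shared by two of them would have two owners. *)
Lemma has_immersion_of_immerses (G' G : sgraph) :
  immerses G' G -> has_immersion G' G.
Proof.
case=> phi [own [phi_inj own_sym conn]].
have /fin_all_exists[P PP] : forall e : {set G'}, exists s : seq G,
    (forall u v, adj u v -> e = [set u; v] -> joins (phi u) (phi v) s) /\
    (e \in edges G' -> forall f, f \in path_edges s ->
      exists x y, f = [set x; y] /\ owned own e x y).
  move=> e.
  case: (boolP (e \in edges G')) => [/imsetP[[u v] uv ->] /=|eN]; last first.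
    exists [::]; split=> // u v uv def_e; case/negP: eN; rewrite def_e.
    by apply/imsetP; exists (u, v).
  have /connectP[p0 pp0 def_v] := conn u v uv.
  case/shortenP: pp0 def_v => p pp up _ def_v.
  exists (phi u :: p); split=> [u' v' _|_ f].
    have puv : path_from_to (phi u) (phi v) (phi u :: p).
      apply/and4P; split; rewrite ?def_v //.
      by apply: sub_path pp => x y /andP[].
    by case/set2_eqP=> [] [<- <-]; rewrite /joins puv ?orbT.
  by rewrite inE; apply: path_pairmap_set2.
exists phi, P; split=> // [u v uv|e f eE fE]; first by apply: (PP _).1.
apply: contraR => /pred0Pn[g /andP[/= ge gf]].
have [x [y [def_g /andP[xy /eqP <-]]]] := (PP e).2 eE g ge.
have [x' [y' [def_g' /andP[_ /eqP <-]]]] := (PP f).2 fE g gf.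
by move: def_g'; rewrite def_g => /set2_eqP[] [<- <-] //; rewrite own_sym.
Qed.

Lemma immerses_trans (G1 G2 G3 : sgraph) :
  immerses G1 G2 -> immerses G2 G3 -> immerses G1 G3.
Proof.
case=> phi [own [phi_inj own_sym conn]] [psi [own' [psi_inj own'_sym conn']]].
(* The owner in [G2] is an unordered pair; the orientation picked is harmless since [own] is
   symmetric. *)
pose own3 x y := if [pick p : G2 * G2 | adj p.1 p.2 && (own' x y == [set p.1; p.2])]
  is Some p then own p.1 p.2 else set0.
exists (psi \o phi), own3; split=> [|x y xy|u v uv]; first exact: inj_comp.
  by rewrite /own3 own'_sym.
apply: connect_map (conn u v uv) => a b /andP[ab /eqP own_ab].
apply: connect_sub (conn' a b ab) => x y /andP[xy /eqP own_xy].
apply: connect1; rewrite /owned /= xy /own3 own_xy.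
case: pickP => [[c d] /= /andP[cd /eqP/set2_eqP[][ac bd]]|/(_ (a, b))] /=.
- by rewrite -ac -bd own_ab.
- by rewrite -ac -bd -own_sym ?own_ab.
- by rewrite ab eqxx.
Qed.

Lemma subgraph_immerses (G' G : sgraph) : is_subgraph G' G -> immerses G' G.
Proof.
case=> f [f_inj f_adj].
exists f, (fun x y => [set u | f u \in [set x; y]]); split=> // [x y _|u v uv].
  by rewrite setUC.
apply: connect1; rewrite /owned /= f_adj //=; apply/eqP/setP=> w.
by rewrite !inE !(inj_eq f_inj).
Qed.

(** * Cliques on finite types and subgraph embeddings *)

Section CliqueOn.
Variable T : finType.

Definition clique_adj : rel T := fun x y => x != y.

Lemma clique_adj_sym : symmetric clique_adj.
Proof. by move=> x y; rewrite /clique_adj eq_sym. Qed.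

Lemma clique_adj_irr : irreflexive clique_adj.
Proof. by move=> x; rewrite /clique_adj eqxx. Qed.

Definition clique : sgraph := SGraph clique_adj_sym clique_adj_irr.
End CliqueOn.

Lemma clique_subgraph_complete (T : finType) n :
  #|T| <= n -> is_subgraph (clique T) (complete n).
Proof.
move=> le_n; exists (fun x => widen_ord le_n (enum_rank x)).
have inj : injective (fun x : T => widen_ord le_n (enum_rank x)).
  by move=> x y /(congr1 val)/= /val_inj/enum_rank_inj.
by split=> // x y; rewrite /= /complete_adj (inj_eq inj).
Qed.

Lemma clique_subgraph_clique (T U : finType) :
  #|T| <= #|U| -> is_subgraph (clique T) (clique U).
Proof.
move=> le_n; exists (fun x => enum_val (widen_ord le_n (enum_rank x))).
have inj : injective (fun x : T => enum_val (A := U) (widen_ord le_n (enum_rank x))).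
  by move=> x y /enum_val_inj/(congr1 val)/= /val_inj/enum_rank_inj.
by split=> // x y; rewrite /= /clique_adj (inj_eq inj).
Qed.

Lemma is_subgraph_trans (G1 G2 G3 : sgraph) :
  is_subgraph G1 G2 -> is_subgraph G2 G3 -> is_subgraph G1 G3.
Proof.
case=> f [f_inj fP] [g [g_inj gP]].
exists (g \o f); split; first exact: inj_comp.
by move=> u v /fP/gP.
Qed.

Lemma is_subgraph_refl (G : sgraph) : is_subgraph G G.
Proof. by exists id; split. Qed.

Lemma direct_product_subgraph (G G' H H' : sgraph) :
  is_subgraph G G' -> is_subgraph H H' ->
  is_subgraph (direct_product G H) (direct_product G' H').
Proof.
case=> f [f_inj fP] [g [g_inj gP]].
exists (fun x => (f x.1, g x.2)); split=> [[a b] [c d] [/f_inj-> /g_inj->]//|x y].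
by case/andP=> /fP fxy /gP gxy; apply/andP.
Qed.

Lemma complete_immerses_set (G : sgraph) (S : {set G}) (own : G -> G -> {set G}) :
  (forall x y, adj x y -> own x y = own y x) ->
  {in S &, forall u v, u != v -> connect (owned own [set u; v]) u v} ->
  immerses (complete #|S|) G.
Proof.
move=> own_sym conn.
exists (enum_val (A := S)), (fun x y => [set i : 'I__ | enum_val i \in own x y]).
split=> [||i j ij]; first exact: enum_val_inj.
  by move=> x y xy; rewrite own_sym.
apply: connect_sub (conn _ _ (enum_valP i) (enum_valP j) _); last first.
  by rewrite (inj_eq enum_val_inj).
move=> x y /andP[xy /eqP own_xy]; apply: connect1; rewrite /owned /= xy own_xy.
by apply/eqP/setP=> k; rewrite !inE !(inj_eq enum_val_inj).
Qed.

(** * Idempotent Latin squares and routes along a path *)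

(** Only products with a <> b occur, so idempotence is kept as what it gives, with the Latin
    property, off the diagonal: [lat_neql] and [lat_neqr]. *)
Record idempotent_latin (V : Type) := IdempotentLatin {
  lat : V -> V -> V;
  lat_ldiv : V -> V -> V;
  lat_rdiv : V -> V -> V;
  lat_neql : forall a b, a <> b -> lat a b <> a;
  lat_neqr : forall a b, a <> b -> lat a b <> b;
  lat_ldivK : forall a b, a <> b -> lat_ldiv a (lat a b) = b;
  lat_rdivK : forall a b, a <> b -> lat_rdiv (lat a b) b = a }.

(** Induction peels off the first edge: the route of (a, b) steps from (x, a) to (x1, ab), then
    follows that of (ab, b). The label [w] recovers (a, b) by left division on the first edge, and
    by right division from the inductive label afterwards. *)
Lemma path_spread (T V : finType) (q : idempotent_latin V) (e : rel T) x p :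
  symmetric e -> path e x p -> uniq (x :: p) -> p != [::] ->
  exists w : T * V -> T * V -> option (V * V),
    (forall y z, w y z = w z y) /\
    forall a b, a <> b ->
      connect [rel y z | [&& e y.1 z.1, y.1 \in x :: p, z.1 \in x :: p,
                             y.2 != z.2 & w y z == Some (a, b)]]
              (x, a) (last x p, b).
Proof.
move=> e_sym; elim: p x => //= x1 p IHp x /andP[xx1 pp] /andP[xNp up] _.
have x1x : (x1 == x) = false by apply: contraNF xNp => /eqP->; rewrite mem_head.
have [p0|/(IHp _ pp up) [w [w_sym conn]]] := eqVneq p [::].
  exists (fun y z => if y.1 == x then if z.1 == x then None else Some (y.2, z.2)
     else if z.1 == x then Some (z.2, y.2) else None); split=> [y z|a b /eqP ab].
    by case: eqP; case: eqP.
  by rewrite p0; apply: connect1; rewrite /= xx1 !inE !eqxx x1x orbT ab /=.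
pose k (o : option (V * V)) := omap (fun ab => (lat_rdiv q ab.1 ab.2, ab.2)) o.
exists (fun y z => if y.1 == x
  then if z.1 == x then None else Some (y.2, lat_ldiv q y.2 z.2)
  else if z.1 == x then Some (z.2, lat_ldiv q z.2 y.2) else k (w y z)).
split=> [y z|a b ab]; first by rewrite w_sym; case: eqP; case: eqP.
apply: (@connect_trans _ _ (x1, lat q a b)).
  apply: connect1; rewrite /= xx1 !inE !eqxx x1x orbT /= lat_ldivK // eqxx andbT.
  by apply/eqP=> /esym; apply: lat_neql.
apply: connect_sub (conn (lat q a b) b (lat_neqr ab)) => y z.
case/and5P=> eyz yp zp yz /eqP wyz; apply: connect1 => /=.
(* The path is simple, so later edges avoid [x] and take the inductive label. *)
have neqx u : u \in x1 :: p -> (u == x) = false.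
  by move=> up'; apply: contraNF xNp => /eqP<-.
by rewrite eyz yz !(in_cons x) yp zp !orbT !neqx //= wyz /= lat_rdivK.
Qed.

(** The projection of an edge to [G] selects the edge of [G']; [path_spread] on the path of the
    latter then selects the pair (a, b). *)
Lemma direct_product_clique_immerses (G' G : sgraph) (V : finType) :
  idempotent_latin V -> immerses G' G ->
  immerses (direct_product G' (clique V)) (direct_product G (clique V)).
Proof.
move=> q [phi [own [phi_inj own_sym conn]]].
have /fin_all_exists[w wP] : forall e : {set G'},
    exists w : G * V -> G * V -> {set G' * V},
    (forall y z, w y z = w z y) /\
    forall u v, adj u v -> e = [set u; v] -> forall a b, a != b ->
      connect [rel y z | [&& owned own e y.1 z.1, y.2 != z.2 &
                             w y z == [set (u, a); (v, b)]]]
              (phi u, a) (phi v, b).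
  move=> e.
  case: (boolP (e \in edges G')) => [/imsetP[[u v] uv ->] /=|eN]; last first.
    exists (fun _ _ => set0); split=> // u v uv def_e; case/negP: eN.
    by rewrite def_e; apply/imsetP; exists (u, v).
  have /connectP[p0 pp0 def_v] := conn u v uv.
  case/shortenP: pp0 def_v => p pp up _ def_v.
  have pN0 : p != [::].
    apply: contraTneq uv => p_nil; move: def_v; rewrite p_nil /= => /phi_inj->.
    by rewrite inE /= adj_irr.
  have [w [w_sym w_conn]] := path_spread q (owned_sym _ own_sym) pp up pN0.
  pose w' y z : {set G' * V} := if w y z is Some ab then [set (u, ab.1); (v, ab.2)] else set0.
  have w'_sym y z : w' y z = w' z y by rewrite /w' w_sym.
  exists w'; split=> // u' v' _ e_eq a b ab.
  have w'_conn a' b' : a' != b' ->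
      connect [rel y z | [&& owned own [set u; v] y.1 z.1, y.2 != z.2 &
                         w' y z == [set (u, a'); (v, b')]]] (phi u, a') (phi v, b').
    move/eqP=> /w_conn; rewrite -def_v; apply: connect_sub => y z.
    case/and5P=> eyz _ _ yz /eqP wyz; apply: connect1.
    by rewrite /= [owned _ _ _ _]eyz yz /w' wyz eqxx.
  case: (set2_eqP e_eq) => [] [<- <-]; first exact: w'_conn.
  rewrite (sym_connect_sym _) => [|y z /=]; last first.
    by rewrite [owned _ _ _ _]owned_sym // w'_sym [y.2 == _]eq_sym.
  by rewrite [[set (v, a); _]]setUC; apply: w'_conn; rewrite eq_sym.
exists (fun x => (phi x.1, x.2)), (fun y z => w (own y.1 z.1) y z).
split=> [[a b] [c d] [/phi_inj-> ->]//|y z /andP[yz _]|[u a] [v b] /andP[/= uv ab]].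
  by rewrite own_sym //; apply: (wP _).1.
apply: connect_sub ((wP _).2 u v uv erefl a b ab) => y z.
case/and3P=> /andP[yz /eqP own_yz] yz2 wyz; apply: connect1.
by rewrite /owned /= /direct_adj /= /clique_adj yz yz2 own_yz.
Qed.

(* Splits the edges of the clique on [V \ o] into colour classes indexed by
   [V \ o], except for the perfect matching [mate] when [leftover] holds.
   [color j k] is the colour of jk, and [partner x j] the other end of the edge
   of colour x at j. Besides j itself, vertex j misses only the colour [free j],
   whose other missed vertex is recovered by [unfree]. *)
Record near_factorization (V : eqType) (o : V) := NearFactorization {
  leftover : bool;
  color : V -> V -> V;
  partner : V -> V -> V;
  mate : V -> V;
  free : V -> V;
  unfree : V -> V;
  colorC : forall j k, color j k = color k j;
  colorP : forall j k, j != o -> k != o -> j != k ->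
    ~~ (leftover && (k == mate j)) ->
    [/\ color j k != o, color j k != j, partner (color j k) j = k
      & ~~ (leftover && (color j k == free j))];
  mateP : leftover -> forall j, j != o ->
    [/\ mate j != o, mate (mate j) = j, free j != o, free j != j
      & unfree (free j) = j] }.

(** * A large clique immersed in the product of two cliques *)

Section CliqueProduct.
Variables (T V : finType) (o : T) (o' : V).
Variables (dT : near_factorization o) (dV : near_factorization o').
Let KK := direct_product (clique T) (clique V).

Definition terminal (x : T * V) := (x.1 != o) && (x.2 != o').

(* Owner of an edge between the terminal x and any y. *)
Definition own_terminal (x y : T * V) : {set T * V} :=
  let: (i, j) := x in let: (k, l) := y in
  if (k == o) == (l == o') then [set x; y]
  else if k == o then
    if leftover dV && (l == free dV j)
    then if leftover dT then [set x; (mate dT i, j)] else [set x; (i, mate dV j)]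
    else [set x; (i, partner dV l j)]
  else
    if leftover dT && (k == free dT i)
    then if leftover dV then [set x; (i, mate dV j)] else [set x; (mate dT i, j)]
    else [set x; (partner dT k i, j)].

(* Owner of the edge joining the hubs (o, l) and (k, o'). *)
Definition own_hub (l : V) (k : T) : {set T * V} :=
  if leftover dV then [set (k, unfree dV l); (k, mate dV (unfree dV l))]
  else [set (unfree dT k, l); (mate dT (unfree dT k), l)].

(** Adjacent non-terminals are always a hub (o, l) and a hub (k, o'), as (o, o') is adjacent to
    terminals only. *)
Definition own_product (x y : KK) : {set KK} :=
  if terminal x then own_terminal x y
  else if terminal y then own_terminal y x
  else if x.1 == o then own_hub x.2 y.1 else own_hub y.2 x.1.

Lemma own_productC (x y : KK) : adj x y -> own_product x y = own_product y x.
Proof.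
case: x y => [i j] [k l] /andP[/= ik jl]; rewrite /own_product /own_terminal /terminal /=.
move: ik jl; rewrite /clique_adj.
case: (eqVneq i o) => [->|iN]; case: (eqVneq k o) => [->|kN];
  case: (eqVneq j o') => [->|jN]; case: (eqVneq l o') => [->|lN] //=;
  rewrite ?eqxx //= => _ _.
by rewrite setUC.
Qed.

Let S : {set KK} := (o, o') |: setX [set~ o] [set~ o'].

Lemma connect_row i j l : i != o -> j != o' -> l != o' -> j != l ->
  connect (owned own_product [set (i, j); (i, l)]) ((i, j) : KK) ((i, l) : KK).
Proof.
move=> iN jN lN jl.
have C := connect_owned_sym (own := own_product) [set (i, j); (i, l)] own_productC.
have oi : o != i by rewrite eq_sym.
case: (boolP (leftover dV && (l == mate dV j))) => [/andP[bV /eqP def_l]|Nl]; last first.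
  have half j1 l1 : j1 != o' -> l1 != o' -> j1 != l1 ->
      ~~ (leftover dV && (l1 == mate dV j1)) ->
      connect (owned own_product [set (i, j1); (i, l1)]) ((i, j1) : KK) (o, color dV j1 l1).
    move=> j1N l1N jl1 /(colorP j1N l1N jl1)[cN cj cK cf].
    apply: connect1; rewrite /owned /= /direct_adj /= /clique_adj iN eq_sym cj /=.
    by rewrite /own_product /terminal /= iN j1N eqxx (negPf cN) (negPf cf) cK.
  apply: connect_trans (half _ _ jN lN jl Nl) _.
  rewrite C [[set _; _]]setUC colorC; apply: half => //; first by rewrite eq_sym.
  apply: contra Nl => /andP[bV /eqP->]; rewrite bV /=.
  by have [_ -> _ _ _] := mateP bV lN.
have [_ mK _ _ _] := mateP bV jN.
have mK' : mate dV l = j by rewrite def_l.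
(* Since [mate] is an involution, a meeting point [z] independent of [j1] lets one half route serve
   both ends. *)
suff [z half] : exists z : KK, forall j1, j1 != o' ->
    connect (owned own_product [set (i, j1); (i, mate dV j1)]) ((i, j1) : KK) z.
  apply: (@connect_trans _ _ z); first by rewrite def_l; apply: half.
  by rewrite C [[set _; _]]setUC -mK'; apply: half.
case bT: (leftover dT).
  have [_ _ gN gi _] := mateP bT iN.
  exists (free dT i, o') => j1 j1N; apply: connect1.
  rewrite /owned /= /direct_adj /= /clique_adj j1N eq_sym gi /=.
  by rewrite /own_product /terminal /= iN j1N (negPf gN) eqxx /= bT eqxx bV.
(* Columns need no edge between hubs here, so the free edge to (o, [free dV j1]) continues to (i,
   o'); [unfree] identifies its user. *)
exists (i, o') => j1 j1N; have [_ _ hN hj hK] := mateP bV j1N.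
apply: (@connect_trans _ _ ((o, free dV j1) : KK)); apply: connect1.
  rewrite /owned /= /direct_adj /= /clique_adj iN eq_sym hj /=.
  by rewrite /own_product /terminal /= iN j1N (negPf hN) eqxx /= bT eqxx bV.
rewrite /owned /= /direct_adj /= /clique_adj oi hN /=.
by rewrite /own_product /terminal /= !eqxx andbF /own_hub bV hK.
Qed.

(** The argument of [connect_row] with the coordinates exchanged. *)
Lemma connect_column i k j : i != o -> k != o -> j != o' -> i != k ->
  connect (owned own_product [set (i, j); (k, j)]) ((i, j) : KK) ((k, j) : KK).
Proof.
move=> iN kN jN ik.
have C := connect_owned_sym (own := own_product) [set (i, j); (k, j)] own_productC.
have oj : o' != j by rewrite eq_sym.
case: (boolP (leftover dT && (k == mate dT i))) => [/andP[bT /eqP def_k]|Nk]; last first.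
  have half i1 k1 : i1 != o -> k1 != o -> i1 != k1 ->
      ~~ (leftover dT && (k1 == mate dT i1)) ->
      connect (owned own_product [set (i1, j); (k1, j)]) ((i1, j) : KK) (color dT i1 k1, o').
    move=> i1N k1N ik1 /(colorP i1N k1N ik1)[cN ci cK cf].
    apply: connect1; rewrite /owned /= /direct_adj /= /clique_adj jN eq_sym ci /=.
    by rewrite /own_product /terminal /= i1N jN eqxx (negPf cN) (negPf cf) cK.
  apply: connect_trans (half _ _ iN kN ik Nk) _.
  rewrite C [[set _; _]]setUC colorC; apply: half => //; first by rewrite eq_sym.
  apply: contra Nk => /andP[bT /eqP->]; rewrite bT /=.
  by have [_ -> _ _ _] := mateP bT kN.
have [_ mK _ _ _] := mateP bT iN.
have mK' : mate dT k = i by rewrite def_k.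
suff [z half] : exists z : KK, forall i1, i1 != o ->
    connect (owned own_product [set (i1, j); (mate dT i1, j)]) ((i1, j) : KK) z.
  apply: (@connect_trans _ _ z); first by rewrite def_k; apply: half.
  by rewrite C [[set _; _]]setUC -mK'; apply: half.
case bV: (leftover dV).
  have [_ _ gN gj _] := mateP bV jN.
  exists (o, free dV j) => i1 i1N; apply: connect1.
  rewrite /owned /= /direct_adj /= /clique_adj i1N eq_sym gj /=.
  by rewrite /own_product /terminal /= jN i1N (negPf gN) eqxx /= bV eqxx bT.
exists (o, j) => i1 i1N; have [_ _ hN hi hK] := mateP bT i1N.
apply: (@connect_trans _ _ ((free dT i1, o') : KK)); apply: connect1.
  rewrite /owned /= /direct_adj /= /clique_adj jN eq_sym hi /=.
  by rewrite /own_product /terminal /= jN i1N (negPf hN) eqxx /= bT eqxx bV.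
rewrite /owned /= /direct_adj /= /clique_adj oj hN /=.
by rewrite /own_product /terminal /= !eqxx /= andbF (negPf hN) /own_hub bV hK.
Qed.

Lemma complete_immerses_clique_product :
  immerses (complete (#|T|.-1 * #|V|.-1).+1) KK.
Proof.
have <- : #|S| = (#|T|.-1 * #|V|.-1).+1.
  by rewrite cardsU1 cardsX !cardsC1 !inE eqxx.
apply: (complete_immerses_set own_productC) => u v uS vS uv.
have center w : terminal w ->
    connect (owned own_product [set w; (o, o')]) (w : KK) ((o, o') : KK).
  case: w => i j tw; apply: connect1.
  rewrite /owned /= /direct_adj /= /clique_adj (andP tw).1 (andP tw).2 /=.
  by rewrite /own_product tw /= !eqxx.
have C := connect_owned_sym (own := own_product) [set u; v] own_productC.
move: uS vS; rewrite !inE => /orP[/eqP def_u|tu] /orP[/eqP def_v|tv].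
- by rewrite def_u def_v eqxx in uv.
- by rewrite C def_u setUC; apply: center.
- by rewrite def_v; apply: center.
case: u v tu tv uv {C} => [i j] [k l] /= /andP[iN jN] /andP[kN lN] uv.
have [ik|ik] := eqVneq i k.
  by rewrite -ik in uv *; apply: connect_row => //; apply: contraNneq uv => ->.
have [jl|jl] := eqVneq j l.
  by rewrite -jl; apply: connect_column.
apply: connect1; rewrite /owned /= /direct_adj /= /clique_adj ik jl /=.
by rewrite /own_product /terminal /= iN jN (negPf kN) (negPf lN) eqxx.
Qed.
End CliqueProduct.

(** * Squares and factorizations from an abelian group with halving *)

Section Halving.
Import GRing.Theory.
Local Open Scope ring_scope.
Variables (Z : zmodType) (half : Z -> Z).
Hypothesis halfK : forall x, half x + half x = x.

Lemma half_eq (x y : Z) : half x = y -> x = y + y.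
Proof. by move=> <-; rewrite halfK. Qed.

Definition latin_group : idempotent_latin Z.
Proof.
exists (fun a b => half (a + b)) (fun a x => x + x - a) (fun x b => x + x - b) => a b ab.
- by move/half_eq/addrI/esym.
- by move/half_eq/addIr.
- by rewrite halfK addrC addKr.
- by rewrite halfK addrK.
Defined.

(* Prolongation along the transversal b = a + 2d, where ab = a + d. *)
Definition latin_option (d : Z) : d != 0 -> idempotent_latin (option Z).
Proof.
move=> dN0.
exists (fun a b => match a, b with
    | Some a, Some b => if b == a + (d + d) then None else Some (half (a + b))
    | Some a, None => Some (a + d)
    | None, Some b => Some (b - d)
    | None, None => None end)
  (fun a x => match a, x with
    | Some a, Some x => if x == a + d then None else Some (x + x - a)
    | Some a, None => Some (a + (d + d))
    | None, Some x => Some (x + d)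
    | None, None => None end)
  (fun x b => match x, b with
    | Some x, Some b => if x == b - d then None else Some (x + x - b)
    | None, Some b => Some (b - (d + d))
    | Some x, None => Some (x - d)
    | None, None => None end) => - [a|] [b|] //= ab.
- by case: eqP => // _ [] /half_eq/addrI/esym ba; apply: ab; rewrite ba.
- by case=> /eqP; rewrite -subr_eq0 addrAC subrr add0r (negPf dN0).
- by case: eqP => // _ [] /half_eq/addIr ba; apply: ab; rewrite ba.
- by case=> /eqP; rewrite -subr_eq0 addrAC subrr add0r oppr_eq0 (negPf dN0).
(* Off the transversal the midpoint is never a + d, the value reserved for the product of a with
   [None]. *)
- case: eqP => [->//|bN]; case: eqP => [/half_eq|_].
    by rewrite addrACA -addrA => /addrI def_b; case: bN; rewrite def_b.
  by rewrite halfK addrC addKr.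
- by rewrite eqxx.
- by rewrite subrK.
- case: eqP => [->|bN]; first by rewrite addrK.
  case: eqP => [/half_eq|_]; last by rewrite halfK addrK.
  rewrite addrACA -opprD addrAC => /addIr def_a; case: bN.
  by rewrite def_a subrK.
- by rewrite addrK.
- by rewrite eqxx.
Defined.

(** Pairs with midpoint 0 are the pairs {j, -j}; as 0 is no colour, they form the leftover matching.
    The edge of colour j/2 at j would end at the removed vertex 0, so that colour is free. *)
Definition near_factorization_group : near_factorization (0 : Z).
Proof.
exists true (fun j k => half (j + k)) (fun x j => x + x - j) -%R half (fun x => x + x).
- by move=> j k; rewrite addrC.
- move=> j k jN kN jk /= kj; split.
  + apply: contraNneq kj => /half_eq; rewrite addr0 => /eqP.
    by rewrite addrC addr_eq0.
  + by apply: contraNneq jk => /half_eq/addrI->.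
  + by rewrite halfK addrC addKr.
  + apply: contraNneq kN => /half_eq; rewrite halfK => /eqP.
    by rewrite -subr_eq0 addrAC subrr add0r.
- move=> _ j jN; split; rewrite ?opprK ?oppr_eq0 ?halfK //.
    by apply: contraNneq jN => /half_eq; rewrite addr0 => ->.
  by apply: contraNneq jN => /half_eq/eqP; rewrite -subr_eq0 opprD addNKr oppr_eq0.
Defined.

(** Every pair in the group gets a colour, so [id] merely fills the fields about the matching. *)
Definition near_factorization_option : near_factorization (None : option Z).
Proof.
exists false
  (fun j k => if j is Some j then if k is Some k then Some (half (j + k)) else None else None)
  (fun x j => if x is Some x then if j is Some j then Some (x + x - j) else None else None)
  id id id => //.
- by move=> [j|] [k|] //; rewrite addrC.
- move=> [j|] [k|] // _ _ jk _; split=> //; last by rewrite halfK addrC addKr.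
  by apply: contraNneq jk => -[/half_eq/addrI->].
Defined.
End Halving.

(** * Odd cyclic groups and existence of the structures *)

Section OddCyclic.
Import GRing.Theory.
Local Open Scope ring_scope.
Variable q : nat.
Let Z := 'I_q.*2.+1.

(** Modulo 2q + 1, the inverse of 2 is q + 1. *)
Definition ord_half (x : Z) : Z := x *+ q.+1.

Lemma ord_mulrn_card (x : Z) : x *+ q.*2.+1 = 0.
Proof. by apply/val_inj; rewrite Zp_mulrn /= modnMl. Qed.

Lemma ord_halfK (x : Z) : ord_half x + ord_half x = x.
Proof.
rewrite -mulrnDr addnS addSn addnn mulrSr.
by rewrite ord_mulrn_card add0r.
Qed.

End OddCyclic.

(** The order [n./2.*2.+1] is odd, hence allows halving: it is n for odd n, where a point is added,
    and n + 1 for even n, where 0 is removed. *)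
Lemma exists_near_factorization n :
  exists (V : finType) (o : V), inhabited (near_factorization o) /\ #|V| = n.+1.
Proof.
have [odd_n|even_n] := boolP (odd n).
  exists (option 'I_n./2.*2.+1), None; split.
    by split; apply: near_factorization_option (@ord_halfK _).
  by rewrite card_option card_ord; congr _.+1; rewrite -add1n -[RHS](odd_double_half n) odd_n.
exists 'I_n./2.*2.+1, 0%R; split.
  by split; apply: near_factorization_group (@ord_halfK _).
by rewrite card_ord -[in RHS](odd_double_half n) (negPf even_n).
Qed.

Lemma exists_idempotent_latin n : 3 <= n ->
  exists V : finType, inhabited (idempotent_latin V) /\ #|V| = n.
Proof.
case: n => // n n_ge2.
have [odd_n|even_n] := boolP (odd n).
  exists (option 'I_n./2.*2.+1); split.
    (* The shift d = 1 must be nonzero, which fails in the trivial group, that is, for a square of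
       order 2. *)
    split; have d_lt : 1 < n./2.*2.+1 by rewrite ltnS double_gt0 half_gt0.
    by apply: (@latin_option _ _ (@ord_halfK _) (Ordinal d_lt)).
  by rewrite card_option card_ord; congr _.+1; rewrite -add1n -[RHS](odd_double_half n) odd_n.
exists 'I_n./2.*2.+1; split.
  by split; apply: latin_group (@ord_halfK _).
by rewrite card_ord -[in RHS](odd_double_half n) (negPf even_n).
Qed.

(** * The bound for direct products *)

Theorem theorem22 (G H : sgraph) (t r : nat)
    (imG : immersion_number G = t) (imH : immersion_number H = r)
    (r_ge3 : (3 <= r)%N) (KrH : is_subgraph (complete r) H) :
  ((t%:Z - 1) * (r%:Z - 1) + 1 <= (immersion_number (direct_product G H))%:Z)%R.
Proof.
have KtG : has_immersion (complete t) G by rewrite -imG; exact: (immersion_numberP G).1.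
case: t r {imG imH} r_ge3 KrH KtG => [|t] [|r] // r_ge3 KrH KtG.
  (* For t = 0 the integer bound is 1 - (r - 1), which is negative. *)
  apply: (@Order.POrderTheory.le_trans _ _ 0%R) => //.
  by case: r r_ge3 {KrH} => [|[|r]].
rewrite !intS ![(1 + _)%R]GRing.addrC !GRing.addrK -PoszM -PoszD lez_nat addn1.
apply: (immersion_numberP _).2; apply: has_immersion_of_immerses.
have [T [o [[dT] cardT]]] := exists_near_factorization t.
have [V [o' [[dV] cardV]]] := exists_near_factorization r.
have [W [[q] cardW]] := exists_idempotent_latin r_ge3.
have := complete_immerses_clique_product dT dV.
rewrite cardT cardV /= => KTV; apply: immerses_trans KTV _.
(* [V] and [W] carry different structures; their equal size is enough to pass from one clique to the
   other. *)
have TtVW : is_subgraph (direct_product (clique T) (clique V))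
    (direct_product (complete t.+1) (clique W)).
  apply: direct_product_subgraph; first by apply: clique_subgraph_complete; rewrite cardT.
  by apply: clique_subgraph_clique; rewrite cardV cardW.
apply: immerses_trans (subgraph_immerses TtVW) _.
have := direct_product_clique_immerses q (immerses_of_has_immersion KtG).
move=> /immerses_trans; apply; apply: subgraph_immerses.
apply: direct_product_subgraph (is_subgraph_refl G) _.
by apply: is_subgraph_trans KrH; apply: clique_subgraph_complete; rewrite cardW.
Qed.
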